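(* Let $N^{+}(s)$ be the number of eigenvalues, counted with multiplicity, in $(0,s]$ of the wave operator $\Box=-\frac{\partial^2}{\partial t^2}+\Delta_x$ on $S^1\times S^2$; that is, $$N^{+}(s)=\sum_{\substack{j\in\mathbb{Z},\ k\in\mathbb{Z}_{\ge 0}\\ 0<j^2-k(k+1)\le s}}(2k+1).$$ Then $$N^{+}(s)=\frac{\pi^2}{4}s^2-\frac{4}{3}s^{3/2}+R_{N^{+}}(s),\qquad R_{N^{+}}(s)=O(s\log s)\quad\text{as } s\to\infty.$$
   Context: $S^1=\mathbb{R}/2\pi\mathbb{Z}$, $S^2$ is the standard unit sphere, and $\Delta_x$ is the (nonpositive) Laplacian on $S^2$. The eigenfunctions of $\Box$ are $e^{ijt}Y_k(x)$ with $j\in\mathbb{Z}$ and $Y_k$ a spherical harmonic of degree $k\ge 0$; the eigenvalue is $j^2-k(k+1)$, and for each pair $(j,k)$ the corresponding space has dimension $2k+1$. *)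

(* Defs.v *)
From mathcomp Require Import all_boot all_order all_algebra.
From mathcomp Require Import all_classical all_reals all_analysis.
From mathcomp Require Import ring lra zify.

Set Implicit Arguments.
Unset Strict Implicit.
Unset Printing Implicit Defensive.

Import Order.TTheory GRing.Theory Num.Theory.
Import numFieldNormedType.Exports.

Local Open Scope classical_set_scope.
Local Open Scope ring_scope.

(* The eigenvalue of -d^2/dt^2 + Delta_x on S^1 x S^2 attached to the
   eigenfunctions e^{ijt} Y_k(x), with Y_k a spherical harmonic of degree k. *)
Definition box_eigenvalue (j : int) (k : nat) : int :=
  j ^+ 2 - k%:Z * (k%:Z + 1).

(* The dimension of the space of spherical harmonics of degree k on S^2. *)
Definition box_multiplicity (k : nat) : nat := (2 * k + 1)%N.

Definition positive_modes (R : realType) (s : R) : set (int * nat) :=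
  [set p | 0 < (box_eigenvalue p.1 p.2)%:~R :> R /\
           (box_eigenvalue p.1 p.2)%:~R <= s].

(* The finitely supported sum \big[_/_]_(p \in A) takes a default value when
   infinitely many terms are nonzero; this lemma shows that it is a genuine sum
   in the definition of Nplus. *)
Lemma finite_positive_modes (R : realType) (s : R) :
  finite_set (positive_modes s).
Proof.
pose n := `|Num.floor s|%N.
have sub : positive_modes s `<=`
    (fun q : nat * nat => (q.1%:Z - (2 * n + 1)%:Z, q.2)) @`
      (`I_(4 * n + 3) `*` `I_n.+1).
  move=> [j k] [/= h0 hs].
  have h0' : 0 < box_eigenvalue j k by rewrite -(ltr0z R).
  have hn : box_eigenvalue j k <= n%:Z.
    by rewrite (le_trans _ (lez_abs _))// -ltzD1 -(ltr_int R)
      (le_lt_trans hs)// floorD1_gt.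
  rewrite /box_eigenvalue in h0' hn.
  pose m := `|j|%N.
  have jE : j ^+ 2 = (m * m)%N%:Z by rewrite /m; lia.
  rewrite jE in h0' hn.
  have km : (k < m)%N by rewrite ltnNge; apply/negP => mk; nia.
  have hk : (k <= n)%N by nia.
  have hm : (m <= 2 * n + 1)%N by rewrite leqNgt; apply/negP => mn; nia.
  have hj : - (2 * n + 1)%:Z <= j <= (2 * n + 1)%:Z by rewrite /m in hm; lia.
  have [i ji] : exists i : nat, j + (2 * n + 1)%:Z = i%:Z.
    by exists (absz (j + (2 * n + 1)%:Z)%R); lia.
  by exists (i, k) => /=; [split => /=; lia | rewrite -ji addrK].
apply: sub_finite_set sub _; apply: finite_image.
by apply: finite_setX; exact: finite_II.
Qed.

(* N^+(s), the number of eigenvalues in (0, s] counted with multiplicity. *)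
Definition Nplus (R : realType) (s : R) : nat :=
  \big[addn/0%N]_(p \in positive_modes s) box_multiplicity p.2.

(* Lets the Landau notations apply at +oo. *)
Canonical pinfty_filter_on (R : numFieldType) :=
  FilterType (pinfty_nbhs R) _.

(* Main.v *)
Require Import Defs.
From mathcomp Require Import all_boot all_order all_algebra.
From mathcomp Require Import all_classical all_reals all_analysis.
From mathcomp Require Import ring lra zify.

(** The positive eigenvalues with [j > 0] have [j > k]. In the shell
    [j = k + a + 1] the eigenvalue is affine in [k], so the admissible [k] form an
    initial segment, of length the integer part of
    [x_a = (s - a ^ 2) / (2 a + 1)]. The multiplicities [2 k + 1] along an initial
    segment add up to the square of its length; with the symmetry [j -> - j] this
    gives [N(s) = 2 \sum_(a < A) floor(x_a) ^ 2], where [A] is the integer part of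
    the square root of [s] ([NplusE]).

    Dropping the integer parts costs at most [2 x_a <= 2 s / (2 a + 1)] in each
    square, hence [O(s log s)] in total. In the expansion of [x_a ^ 2] the term
    [s ^ 2 / (2 a + 1) ^ 2] sums to [s ^ 2 (pi ^ 2 / 8 - t)], where the tail [t] is
    [1 / (4 A) + O(1 / A ^ 2)]; the other terms sum to [- s A / 2 + A ^ 3 / 12] up
    to [O(s log s)] ([Nplus_estimate]). As [A] is the square root of [s] up to 1,
    the tail and these two sums together produce the coefficient [- 4 / 3] of
    [s ^ (3 / 2)] ([main_term_bounds]).

    The value [pi ^ 2 / 8] of the sum of the inverse odd squares is obtained from
    the closed form of the sum of [1 / sin ^ 2] over the odd multiples of
    [pi / 2 ^ (n + 2)] in [(0, pi / 2)], by comparing [1 / sin ^ 2 x] with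
    [1 / x ^ 2] ([sum_inv_sqr_sin], [sum_inv_odd_sqr_tail]). *)

Import Order.TTheory GRing.Theory Num.Theory.
Import numFieldNormedType.Exports.

Local Open Scope classical_set_scope.
Local Open Scope ring_scope.

(** * The sum of the inverse odd squares *)

(** By the mean value theorem [sin x = cos c * x] with [0 <= c <= x], and [cos]
    decreases on [[0, pi]]. *)
Lemma cosM_le_sin_le_id (R : realType) (x : R) : 0 <= x <= pi ->
  cos x * x <= sin x <= x.
Proof.
move=> /andP[x0 xpi].
have [c] := @MVT_segment R sin cos 0 x x0 (fun y _ => is_derive_sin y)
  (continuous_subspaceT (@continuous_sin R)).
rewrite in_itv/= => /andP[c0 cx]; rewrite sin0 !subr0 => ->.
rewrite ler_wpM2r ?ler_piMl ?cos_le1//=.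
by rewrite leNgt ltr_cos ?in_itv/= ?x0 ?c0 ?(le_trans cx)// -leNgt.
Qed.

(** The left side is the squared cotangent, so this is the comparison
    [sin x <= x <= tan x] inverted and squared. *)
Lemma inv_sqr_sin_bounds (R : realType) (x : R) : 0 < x < pi / 2 ->
  (sin x ^+ 2)^-1 - 1 <= (x ^+ 2)^-1 <= (sin x ^+ 2)^-1.
Proof.
move=> /andP[x0 xpi].
have s0 : 0 < sin x by apply: sin_gt0_pihalf; rewrite x0.
have c0 : 0 < cos x by apply: cos_gt0_pihalf; lra.
have /andP[cxs sx] : cos x * x <= sin x <= x by apply: cosM_le_sin_le_id; lra.
have := cos2Dsin2 x.
move: (sin x) (cos x) s0 c0 cxs sx => s c s0 c0 cxs sx cs.
have -> : (s ^+ 2)^-1 - 1 = (x ^+ 2)^-1 - (s ^+ 2 - (c * x) ^+ 2) / (x * s) ^+ 2.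
  have -> : (s ^+ 2)^-1 - 1 = (1 - s ^+ 2) / s ^+ 2 by field; rewrite lt0r_neq0.
  by rewrite -cs addrK; field; rewrite !lt0r_neq0.
rewrite gerBl divr_ge0 ?sqr_ge0//=.
  by rewrite lef_pV2 ?posrE ?exprn_gt0// ler_pXn2r// nnegrE ltW.
by rewrite subr_ge0 ler_pXn2r// nnegrE ltW// mulr_gt0.
Qed.

(** The duplication formula that drives the dyadic evaluation below: an angle [x]
    is replaced by the two angles [x / 2] and [pi / 2 - x / 2], whose sine is
    [cos (x / 2)]. *)
Lemma inv_sqr_sin_half (R : realType) (x : R) : 0 < x < pi ->
  (sin x ^+ 2)^-1 =
  ((sin (x / 2) ^+ 2)^-1 + (sin (pi / 2 - x / 2) ^+ 2)^-1) / 4.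
Proof.
move=> /andP[x0 xpi].
have s0 : 0 < sin (x / 2) by apply: sin_gt0_pihalf; lra.
have c0 : 0 < cos (x / 2) by apply: cos_gt0_pihalf; lra.
have -> : sin (pi / 2 - x / 2) = cos (x / 2).
  by rewrite sinB sin_pihalf cos_pihalf mul0r mul1r subr0.
have {1}-> : x = (x / 2) *+ 2 by rewrite mulr2n; lra.
have := cos2Dsin2 (x / 2).
rewrite sin_mulr2n mulr2n.
move: (sin (x / 2)) (cos (x / 2)) s0 c0 => s c s0 c0 cs.
have -> : (s ^+ 2)^-1 + (c ^+ 2)^-1 = (c ^+ 2 + s ^+ 2) / (s ^+ 2 * c ^+ 2).
  by field; rewrite !lt0r_neq0.
by rewrite cs; field; rewrite !lt0r_neq0.
Qed.

(** The angles are the odd multiples of [pi / 2 ^ n.+2] in [(0, pi / 2)].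
    Halving each of them and taking the complement of the half in [pi / 2]
    yields exactly the odd multiples of [pi / 2 ^ n.+3] in the same interval, so
    each step multiplies the sum by 4. *)
Lemma sum_inv_sqr_sin (R : realType) n :
  \sum_(k < 2 ^ n) (sin ((2 * k + 1)%:R * (pi / 2 ^+ n.+2)) ^+ 2)^-1 =
  2 * 4 ^+ n :> R.
Proof.
have pi0 := pi_gt0 R.
elim: n => [|n IHn].
  have := @inv_sqr_sin_half R (pi / 2).
  have -> : pi / 2 - pi / 2 / 2 = pi / 2 / 2 :> R by lra.
  have -> : pi / 2 / 2 = 1 * (pi / 2 ^+ 2) :> R by lra.
  rewrite expn0 big_ord1 sin_pihalf muln0 add0n; lra.
rewrite expnS mul2n -addnn big_split_ord/=.
(* The complement of half the k-th angle is the angle of index 2 ^ n.+1 - 1 - k. *)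
rewrite [X in _ + X](reindex_inj rev_ord_inj)/= -big_split/=.
rewrite [in RHS]exprS [RHS]mulrCA -IHn mulr_sumr; apply: eq_bigr => k _.
have kn : (2 * k + 1 < 2 ^ n.+2)%N by rewrite !expnS; have := ltn_ord k; lia.
have pow0 : 0 < 2 ^+ n.+2 :> R by rewrite exprn_gt0.
have xlt : (2 * k + 1)%:R * (pi / 2 ^+ n.+2) < pi :> R.
  by rewrite mulrCA gtr_pMr// ltr_pdivrMr// mul1r -natrX ltr_nat.
have k0 : 0 < (2 * k + 1)%:R :> R by rewrite ltr0n addn1.
rewrite [in RHS]inv_sqr_sin_half ?xlt ?mulr_gt0 ?invr_gt0//.
rewrite [RHS]mulrCA mulfV// mulr1.
have -> : (2 * (2 ^ n + (2 ^ n - k.+1)) + 1)%:R = 2 ^+ n.+2 - (2 * k + 1)%:R :> R.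
  rewrite -natrX -natrB ?(ltnW kn)//; congr _%:R.
  by rewrite !expnS; have := ltn_ord k; lia.
rewrite (exprS _ n.+2); move: (2 ^+ n.+2) ((2 * k + 1)%:R : R) pow0 {k0 xlt} => p q p0.
by congr ((sin _ ^+ 2)^-1 + (sin _ ^+ 2)^-1); field; rewrite lt0r_neq0.
Qed.

(** Replacing [1 / sin ^ 2] by [1 / x ^ 2] in the trigonometric sum costs at most
    1 for each of its [2 ^ n] terms, while its value is of order [4 ^ n]. *)
Lemma sum_inv_odd_sqr_dyadic (R : realType) n :
  (@pi R) ^+ 2 / 8 - pi ^+ 2 / 16 / 2 ^+ n <=
    \sum_(k < 2 ^ n) ((2 * k + 1)%:R ^+ 2)^-1 <= @pi R ^+ 2 / 8.
Proof.
have pi0 := pi_gt0 R.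
have pow0 : 0 < 2 ^+ n :> R by rewrite exprn_gt0.
pose y (k : 'I_(2 ^ n)) : R := (2 * k + 1)%:R * (pi / 2 ^+ n.+2).
have yP k : (sin (y k) ^+ 2)^-1 - 1 <= (y k ^+ 2)^-1 <= (sin (y k) ^+ 2)^-1.
  have k0 : 0 < (2 * k + 1)%:R :> R by rewrite ltr0n addn1.
  apply: inv_sqr_sin_bounds; rewrite /y mulr_gt0 ?divr_gt0 ?exprn_gt0//.
  have kn : (2 * k + 2 <= 2 ^ n.+1)%N by rewrite expnS; have := ltn_ord k; lia.
  rewrite mulrCA ltr_pM2l// ltr_pdivrMr ?exprn_gt0// [in ltRHS]exprS mulKf//.
  by rewrite -natrX ltr_nat; lia.
have yE : \sum_(k < 2 ^ n) ((2 * k + 1)%:R ^+ 2)^-1 =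
    pi ^+ 2 / 16 / 4 ^+ n * \sum_k (y k ^+ 2)^-1.
  rewrite mulr_sumr; apply: eq_bigr => k _; rewrite /y !exprS.
  have -> : 4 ^+ n = 2 ^+ n * 2 ^+ n :> R by rewrite -exprMn -natrM.
  have : 0 < (2 * k + 1)%:R :> R by rewrite ltr0n addn1.
  by move: (pi : R) pi0 ((2 * k + 1)%:R : R) => p p0 q q0;
    rewrite expr0; field; rewrite !lt0r_neq0.
have up : \sum_k (y k ^+ 2)^-1 <= 2 * 4 ^+ n.
  by rewrite -sum_inv_sqr_sin; apply: ler_sum => k _; have /andP[] := yP k.
have lo : 2 * 4 ^+ n - 2 ^+ n <= \sum_k (y k ^+ 2)^-1.
  have -> : 2 ^+ n = \sum_(k < 2 ^ n) (1 : R).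
    by rewrite sumr_const card_ord natrX.
  by rewrite -sum_inv_sqr_sin -sumrB; apply: ler_sum => k _; have /andP[] := yP k.
have -> : @pi R ^+ 2 / 8 - pi ^+ 2 / 16 / 2 ^+ n =
    pi ^+ 2 / 16 / 4 ^+ n * (2 * 4 ^+ n - 2 ^+ n).
  have -> : 4 ^+ n = 2 ^+ n * 2 ^+ n :> R by rewrite -exprMn -natrM.
  by move: (pi : R) => p; field; rewrite lt0r_neq0.
have -> : @pi R ^+ 2 / 8 = pi ^+ 2 / 16 / 4 ^+ n * (2 * 4 ^+ n).
  by move: (pi : R) => p; field; rewrite lt0r_neq0// exprn_gt0.
by rewrite yE !ler_pM2l ?lo ?up// !divr_gt0 ?exprn_gt0.
Qed.

(** Both sides telescope, because
    [1 / ((2 k + 1) (2 k + 3)) <= 1 / (2 k + 1) ^ 2 <= 1 / (2 k (2 k + 2))]. *)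
Lemma sum_inv_odd_sqr_block (R : realFieldType) A d : (0 < A)%N ->
  (4 * A%:R + 2)^-1 - (4 * (A + d)%:R + 2)^-1 <=
    (\sum_(k < A + d) ((2 * k + 1)%:R ^+ 2)^-1 -
    \sum_(k < A) ((2 * k + 1)%:R ^+ 2)^-1 : R) <=
  (4 * A%:R)^-1 - (4 * (A + d)%:R)^-1.
Proof.
move=> A0; elim: d => [|d]; first by rewrite addn0 !subrr !lexx.
rewrite addnS big_ord_recr/= -[(A + d).+1%:R]natr1.
have -> : (2 * (A + d) + 1)%:R = 2 * (A + d)%:R + 1 :> R by rewrite natrD natrM.
have : 0 < (A + d)%:R :> R by rewrite ltr0n; lia.
move: (A + d)%:R => B B0.
set S := \sum_(_ < _) _; set S' := \sum_(_ < _) _.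
have lo : (4 * B + 2)^-1 - (4 * (B + 1) + 2)^-1 <= ((2 * B + 1) ^+ 2)^-1.
  have -> : (4 * B + 2)^-1 - (4 * (B + 1) + 2)^-1 =
      ((2 * B + 1) ^+ 2)^-1 - 2 / ((2 * B + 1) ^+ 2 * (2 * B + 3)).
    by field; rewrite !lt0r_neq0//; lra.
  by rewrite gerBl divr_ge0// mulr_ge0 ?sqr_ge0//; lra.
have up : ((2 * B + 1) ^+ 2)^-1 <= (4 * B)^-1 - (4 * (B + 1))^-1.
  have -> : (4 * B)^-1 - (4 * (B + 1))^-1 =
      ((2 * B + 1) ^+ 2)^-1 + 1 / ((2 * B + 1) ^+ 2 * (4 * B * (B + 1))).
    by field; rewrite !lt0r_neq0//; lra.
  by rewrite lerDl divr_ge0// !mulr_ge0 ?sqr_ge0//; lra.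
move=> /andP[? ?]; apply/andP; split; lra.
Qed.

(** The series has sum [pi ^ 2 / 8] by the dyadic bounds, so the difference is
    its tail, which the telescoping bounds locate up to [O(1 / A ^ 2)]. *)
Lemma sum_inv_odd_sqr_tail (R : realType) A : (0 < A)%N ->
  (4 * A%:R + 2)^-1 <=
    @pi R ^+ 2 / 8 - \sum_(k < A) ((2 * k + 1)%:R ^+ 2)^-1 <= (4 * A%:R)^-1.
Proof.
move=> A0; have pi0 := pi_gt0 R.
have p0 : 0 < @pi R ^+ 2 + 1 by rewrite ltr_wpDl ?sqr_ge0.
set S := \sum_(_ < _) _.
suff bnd e : 0 < e -> (4 * A%:R + 2)^-1 <= pi ^+ 2 / 8 - S + e /\
    pi ^+ 2 / 8 - S <= (4 * A%:R)^-1 + e.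
  by apply/andP; split; apply/ler_addgt0Pr => e /bnd[].
(* 2 ^ n is at least A, and large enough for both errors, the one at 2 ^ n in
   the dyadic bounds and the remaining tail, to be below e. *)
move=> e0; pose n := maxn A (Num.truncn ((pi ^+ 2 + 1) / e)).+1.
have n2 : (n < 2 ^ n)%N by rewrite ltn_expl.
have An : (A + (2 ^ n - A) = 2 ^ n)%N by rewrite subnKC//; lia.
have pe : (pi ^+ 2 + 1) / 2 ^+ n <= e.
  rewrite ler_pdivrMr ?exprn_gt0// mulrC -ler_pdivrMr//.
  apply/ltW/(lt_le_trans (truncnS_gt _)); rewrite -natrX ler_nat.
  by rewrite (leq_trans _ (ltnW n2))// leq_maxr.
have := sum_inv_odd_sqr_block R _ (2 ^ n - A) A0; rewrite An -/S natrX.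
have := sum_inv_odd_sqr_dyadic R n.
move: (\sum_(_ < _) _) => T /andP[Tlo Tup] /andP[Blo Bup].
have pow0 : 0 < 2 ^+ n :> R by rewrite exprn_gt0.
have lo : (4 * 2 ^+ n + 2)^-1 <= (2 ^+ n)^-1 :> R.
  by rewrite lef_pV2 ?posrE//; lra.
have v0 : 0 < (2 ^+ n)^-1 :> R by rewrite invr_gt0.
have w0 : 0 < (4 * 2 ^+ n)^-1 :> R by rewrite invr_gt0 mulr_gt0.
have q0 : 0 <= pi ^+ 2 / 2 ^+ n :> R by rewrite divr_ge0 ?sqr_ge0// ltW.
have t16 : pi ^+ 2 / 16 / 2 ^+ n = pi ^+ 2 / 2 ^+ n / 16 :> R by rewrite mulrAC.
rewrite mulrDl mul1r in pe.
rewrite t16 in Tlo.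
split; lra.
Qed.

(** * Elementary sums and inequalities *)

(** Each term with [a > 0] is at most [1 / (a + 1)], which is at most
    [ln (a + 1) - ln a]. *)
Lemma sum_inv_odd_le (R : realType) A : (0 < A)%N ->
  \sum_(a < A) (2 * a%:R + 1)^-1 <= 1 + ln A%:R :> R.
Proof.
case: A => // A _; elim: A => [|A IHA].
  by rewrite big_ord1 ln1 mulr0 add0r invr1 addr0.
rewrite big_ord_recr/=; apply: le_trans (lerD IHA _)
  (_ : 1 + ln A.+1%:R + - ln (A.+1%:R / A.+2%:R) <= _).
  have -> : A.+1%:R / A.+2%:R = 1 + - A.+2%:R^-1 :> R.
    by rewrite -[A.+2%:R]natr1; have := ltr0Sn R A; move: (_%:R : R) => x x0; field; lra.
  rewrite lerNr (le_trans (le_ln1Dx _))//.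
    by rewrite ltrN2 invf_lt1// ltr1n.
  rewrite lerN2 lef_pV2 ?posrE// -?[A.+2%:R]natr1 ?ltr_wpDl ?mulr_ge0//.
  by have := ler0n R A.+1; lra.
by rewrite ln_div ?posrE// opprB addrA addrAC addrK.
Qed.

Lemma sum_nat_bounds (R : realFieldType) A :
  \sum_(a < A) a%:R <= A%:R ^+ 2 / 2 :> R /\
  A%:R ^+ 3 / 3 - A%:R ^+ 2 / 2 <= (\sum_(a < A) a%:R ^+ 2 : R) <= A%:R ^+ 3 / 3.
Proof.
elim: A => [|A [IH1 /andP[IH2 IH3]]].
  by rewrite !big_ord0 !expr0n/= !mul0r subrr !lexx.
rewrite !big_ord_recr/= -natr1; have := ler0n R A.
move: (A%:R) (\sum_(_ < _) _) (\sum_(_ < _) _) IH1 IH2 IH3 => x S T *.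
split; first by nra.
by apply/andP; split; nra.
Qed.

(** With [u = 1 / (2 a + 1)] one has [a u = (1 - u) / 2], hence [(a u) ^ 2] is
    [1 / 4] up to [u / 2]; expand [(s u - a (a u)) ^ 2] accordingly. *)
Lemma shell_sqr_bounds (R : realFieldType) (s a : R) : 0 <= a -> 0 <= s ->
  s ^+ 2 * ((2 * a + 1) ^+ 2)^-1 - s / 2 + a ^+ 2 / 4 - a / 4 <=
   ((s - a ^+ 2) / (2 * a + 1)) ^+ 2 <=
  s ^+ 2 * ((2 * a + 1) ^+ 2)^-1 - s / 2 + s * (2 * a + 1)^-1 + a ^+ 2 / 4.
Proof.
move=> a0 s0; rewrite -exprVn.
have d0 : 0 < 2 * a + 1 by lra.
have auE : a * (2 * a + 1)^-1 = (1 - (2 * a + 1)^-1) / 2.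
  by field; rewrite lt0r_neq0.
have u0 : 0 < (2 * a + 1)^-1 by rewrite invr_gt0.
have u1 : (2 * a + 1)^-1 <= 1 by rewrite invf_le1//; lra.
move: (_^-1) auE u0 u1 => u auE u0 u1.
have -> : ((s - a ^+ 2) * u) ^+ 2 =
  s ^+ 2 * u ^+ 2 - 2 * s * (a * u) ^+ 2 + a ^+ 2 * (a * u) ^+ 2 by ring.
have /andP[b1 b2] : 1 / 4 - u / 2 <= (a * u) ^+ 2 <= 1 / 4.
  by rewrite auE; apply/andP; split; nra.
have au0 : 0 <= a * u by rewrite mulr_ge0// ltW.
have a2u : a ^+ 2 * u = (a - a * u) / 2 by rewrite expr2 -mulrA [in LHS]auE; ring.
have := ler_wpM2l s0 b1; have := ler_wpM2l s0 b2.
have := ler_wpM2l (sqr_ge0 a) b1; have := ler_wpM2l (sqr_ge0 a) b2.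
by move=> h1 h2 h3 h4; apply/andP; split; lra.
Qed.

(** Here [r] is the square root of [s], [A] its integer part and [t] the tail
    of the series of inverse odd squares. To leading order [A] is [r] and [t] is
    [1 / (4 r)], and the coefficients of [r ^+ 3] cancel:
    [- 1/2 - 1 + 1/6 + 4/3 = 0]. *)
Lemma main_term_bounds (R : realFieldType) (r A t : R) :
  2 <= r -> A <= r -> r < A + 1 -> (4 * A + 2)^-1 <= t -> t <= (4 * A)^-1 ->
  - (3 / 2) * r ^+ 2 <= - 2 * r ^+ 4 * t - r ^+ 2 * A + A ^+ 3 / 6 + 4 / 3 * r ^+ 3
    <= 5 / 4 * r ^+ 2.
Proof.
move=> r2 Ar rA tlo tup.
have r0 : 0 < r by lra.
have t1 : r ^+ 4 * t <= r ^+ 3 / 4 + r ^+ 2 / 2.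
  have : t <= (4 * r)^-1 + (2 * r ^+ 2)^-1.
    apply: le_trans tup _.
    rewrite -[leLHS]mul1r ler_pdivrMr; last by lra.
    have -> : ((4 * r)^-1 + (2 * r ^+ 2)^-1) * (4 * A) = A * (r + 2) / r ^+ 2.
      by field; rewrite lt0r_neq0.
    by rewrite ler_pdivlMr ?exprn_gt0//; nra.
  move=> /(ler_wpM2l (ltW (exprn_gt0 4 r0))) /le_trans; apply.
  by rewrite le_eqVlt; apply/orP; left; apply/eqP; field; rewrite lt0r_neq0.
have t2 : r ^+ 3 / 4 - r ^+ 2 / 8 <= r ^+ 4 * t.
  have : (4 * r)^-1 - (8 * r ^+ 2)^-1 <= t.
    apply: le_trans _ tlo.
    rewrite -[leRHS]mul1r ler_pdivlMr; last by lra.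
    have -> : ((4 * r)^-1 - (8 * r ^+ 2)^-1) * (4 * A + 2) =
       (2 * r - 1) * (2 * A + 1) / (4 * r ^+ 2).
      by field; rewrite lt0r_neq0.
    by rewrite ler_pdivrMr ?mulr_gt0 ?exprn_gt0//; nra.
  move=> /(ler_wpM2l (ltW (exprn_gt0 4 r0))); apply: le_trans.
  by rewrite le_eqVlt; apply/orP; left; apply/eqP; field; rewrite lt0r_neq0.
have A1 : r ^+ 3 - r ^+ 2 <= r ^+ 2 * A <= r ^+ 3.
  by rewrite !exprS; apply/andP; split; nra.
have A3 : r ^+ 3 - 3 * r ^+ 2 <= A ^+ 3 <= r ^+ 3.
  apply/andP; split; last by rewrite ler_pXn2r ?nnegrE//; lra.
  have : (r - 1) ^+ 3 <= A ^+ 3 by rewrite ler_pXn2r ?nnegrE//; lra.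
  by apply: le_trans; rewrite !exprS; nra.
move: A1 A3 => /andP[? ?] /andP[? ?].
by apply/andP; split; lra.
Qed.

(** * The eigenvalue count as a sum of squares *)

Lemma sum_odd n : (\sum_(k < n) (2 * k + 1) = n ^ 2)%N.
Proof. by elim: n => [|n IHn]; rewrite ?big_ord0// big_ord_recr/= IHn; lia. Qed.

(** The modes with [j > 0] and positive eigenvalue at most [n], sorted by
    [a = j - k - 1]: the eigenvalue is [(2 a + 1) k + (a + 1) ^ 2], and
    [k < (n - a ^ 2) %/ (2 a + 1)] says that it is at most [n]. The quotient
    vanishes when [n < (a + 1) ^ 2], so the first [A] shells contain all these
    modes as soon as [n < (A + 1) ^ 2]. *)
Definition positive_mode_list (A n : nat) : seq (int * nat) :=
  [seq ((k + a.+1)%:Z, k) |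
    a <- iota 0 A, k <- iota 0 ((n - a ^ 2) %/ (2 * a + 1))].

Lemma positive_mode_listP A n (j : int) k : (n < A.+1 ^ 2)%N ->
  reflect (0 < j /\ 0 < box_eigenvalue j k <= n%:Z)
          ((j, k) \in positive_mode_list A n).
Proof.
move=> nA; apply: (iffP allpairsPdep) => [[a [b [+ + [-> ->]]]]|].
  rewrite !mem_iota/= /box_eigenvalue => an.
  rewrite add0n leq_divRL ?addn1// => bq.
  split; first by lia.
  by apply/andP; split; nia.
rewrite /box_eigenvalue => -[j0 /andP[h0 hn]].
have [a ja] : exists a : nat, j = (k + a.+1)%:Z.
  exists (`|j|%N - k.+1)%N.
  have jE : j = `|j|%N%:Z by lia.
  rewrite jE in h0.
  have : (k < `|j|)%N by rewrite ltnNge; apply/negP => ?; nia.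
  by lia.
exists a, k; rewrite ja in hn *; split=> //; rewrite mem_iota/= add0n.
  by rewrite ltnNge; apply/negP => Aa; nia.
by rewrite leq_divRL ?addn1//; nia.
Qed.

Arguments positive_mode_listP {A n j k}.

Lemma positive_mode_list_uniq A n : uniq (positive_mode_list A n).
Proof.
apply: allpairs_uniq_dep; [exact: iota_uniq | by move=> *; exact: iota_uniq |].
move=> [a k] [b l] _ _ /= [/eqP + kl]; rewrite -kl => /eqP ab.
by have -> : a = b by lia.
Qed.

(** The modes with [j < 0] mirror those with [j > 0], there is none with [j = 0],
    and the multiplicities in one shell [j - k - 1 = a] are consecutive odd numbers
    starting from 1, which add up to a square. *)
Lemma NplusE (R : realType) (s : R) A : 0 <= s -> s < A.+1%:R ^+ 2 ->
  Nplus s =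
  (2 * \sum_(a < A) ((Num.truncn s - a ^ 2) %/ (2 * a + 1)) ^ 2)%N.
Proof.
move=> s0 sA; set n := Num.truncn s; pose r := positive_mode_list A n.
have nA : (n < A.+1 ^ 2)%N by rewrite truncn_lt_nat// natrX.
have eig (m : int) : (0 < m%:~R :> R /\ m%:~R <= s) <-> 0 < m <= n%:Z.
  rewrite ltr0z; split=> [[]|/andP[]].
    by case: m => // m m0; rewrite m0/= /n lez_nat truncn_ge_nat.
  by case: m => // m m0; rewrite lez_nat truncn_ge_nat.
have -> : Nplus s = \big[addn/0%N]_(p <- r ++ [seq (- p.1, p.2) | p <- r])
    box_multiplicity p.2.
  rewrite /Nplus [RHS]fsbig_seq; last first.
    rewrite cat_uniq positive_mode_list_uniq/= map_inj_uniq; last first.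
      by move=> [j k] [j' k'] /= [/oppr_inj -> ->].
    rewrite positive_mode_list_uniq andbT.
    apply/hasPn => -[j k] /mapP[[j' k'] + /= [-> ->]].
    move=> /(positive_mode_listP nA)[j0 _].
    by apply/negP => /(positive_mode_listP nA)[]; lia.
  congr (\big[addn/0%N]_(p \in _) _); apply/seteqP; split=> -[j k] /=.
    move/eig => jk; rewrite mem_cat.
    case: (ltgtP j 0) => [j0|j0|j0].
    - apply/orP; right; apply/mapP; exists (- j, k); last by rewrite /= opprK.
      apply/(positive_mode_listP nA); rewrite oppr_gt0; split=> //.
      by move: jk; rewrite /box_eigenvalue sqrrN.
    - by apply/orP; left; apply/(positive_mode_listP nA).
    - by move: jk; rewrite /box_eigenvalue j0 expr2 mul0r; nia.
  rewrite mem_cat => /orP[/(positive_mode_listP nA)[_ /eig//]|].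
  move=> /mapP[[j' k'] + [-> ->]] => /(positive_mode_listP nA)[_].
  by rewrite /positive_modes/= /box_eigenvalue sqrrN => /eig.
rewrite big_cat big_map/= addnn -mul2n; congr (2 * _)%N.
rewrite big_allpairs_dep -{1}[A]subn0 -/(index_iota 0 A) big_mkord.
apply: eq_bigr => a _; rewrite -[RHS]sum_odd.
by rewrite -(big_mkord xpredT (fun k => 2 * k + 1)%N) /index_iota subn0.
Qed.

(** The integer quotient is the integer part of the real one; the integer parts
    of [s] and of the fraction commute because the divisor is an integer. *)
Lemma mode_count_bounds (R : realType) (s : R) a : a%:R ^+ 2 <= s ->
  ((Num.truncn s - a ^ 2) %/ (2 * a + 1))%:R <=
    (s - a%:R ^+ 2) / (2 * a%:R + 1) <=
  ((Num.truncn s - a ^ 2) %/ (2 * a + 1))%:R + 1.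
Proof.
move=> as_; have s0 : 0 <= s by rewrite (le_trans _ as_)// sqr_ge0.
have := truncn_itv s0; rewrite -natrX -truncn_ge_nat// in as_.
move: (Num.truncn s) as_ => n an /andP[ns sn].
have d0 : 0 < 2 * a%:R + 1 :> R by rewrite ltr_wpDl ?mulr_ge0.
have dE : 2 * a%:R + 1 = (2 * a + 1)%:R :> R by rewrite natrD natrM.
have d0n : (0 < 2 * a + 1)%N by rewrite addn1.
have qlo := leq_divM (n - a ^ 2) (2 * a + 1).
have qup := ltn_ceil (n - a ^ 2) d0n.
rewrite ler_pdivlMr// ler_pdivrMr// lerBrDr lerBlDr dE natr1.
rewrite -natrX -!natrM -!natrD.
move: ((n - a ^ 2) %/ (2 * a + 1))%N qlo qup => q qlo qup.
apply/andP; split.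
  by apply: le_trans ns; rewrite ler_nat; lia.
by apply: le_trans (ltW sn) _; rewrite ler_nat; lia.
Qed.

(** * The asymptotic estimate *)

(** Removing the integer parts from the squares in [NplusE] changes the sum by at
    most twice the sum of the [s / (2 a + 1)], which is where the logarithm comes
    from; the remaining sum of squares is explicit. *)
Lemma Nplus_estimate (R : realType) (s : R) (A : nat) :
  A%:R ^+ 2 <= s -> s < A.+1%:R ^+ 2 ->
  - (A%:R ^+ 2 / 2 + 4 * s * \sum_(a < A) (2 * a%:R + 1)^-1) <=
    (Nplus s)%:R - (2 * s ^+ 2 * \sum_(a < A) ((2 * a + 1)%:R ^+ 2)^-1
                    - s * A%:R + A%:R ^+ 3 / 6) <=
  2 * s * \sum_(a < A) (2 * a%:R + 1)^-1.
Proof.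
move=> As sA.
set H : R := \sum_(_ < A) _; set S : R := \sum_(_ < A) _.
have s0 : 0 <= s by rewrite (le_trans _ As)// sqr_ge0.
rewrite (NplusE R s A)// natrM natr_sum.
under eq_bigr do rewrite natrX.
set Q : R := \sum_(_ < A) _.
have [U1 /andP[U2 U3]] := sum_nat_bounds R A.
have bnd (a : 'I_A) :
  s ^+ 2 * ((2 * a + 1)%:R ^+ 2)^-1 - s / 2 + a%:R ^+ 2 / 4 - a%:R / 4 -
    2 * s * (2 * a%:R + 1)^-1 <=
  ((Num.truncn s - a ^ 2) %/ (2 * a + 1))%:R ^+ 2 <=
  s ^+ 2 * ((2 * a + 1)%:R ^+ 2)^-1 - s / 2 + s * (2 * a%:R + 1)^-1 + a%:R ^+ 2 / 4.
  have as_ : a%:R ^+ 2 <= s.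
    by rewrite (le_trans _ As)// ler_pXn2r ?nnegrE// ler_nat ltnW.
  have /andP[] := mode_count_bounds R s a as_.
  have /andP[] := shell_sqr_bounds R s a%:R (ler0n _ _) s0.
  have -> : (2 * a + 1)%:R = 2 * a%:R + 1 :> R by rewrite natrD natrM.
  move: (_ %/ _)%N => q.
  have xs : (s - a%:R ^+ 2) / (2 * a%:R + 1) <= s * (2 * a%:R + 1)^-1.
    by rewrite ler_wpM2r ?invr_ge0 ?addr_ge0 ?mulr_ge0// gerBl sqr_ge0.
  move: ((s - a%:R ^+ 2) / _) xs (ler0n R q) => x xs q0 h1 h2 qx xq.
  apply/andP; split; last by apply: le_trans h2; rewrite ler_pXn2r ?nnegrE// (le_trans q0).
  (* x ^ 2 - q ^ 2 = (x - q) (x + q), with x - q <= 1 and x + q <= 2 x. *)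
  have d0 : 0 <= 1 - (x - q%:R) by lra.
  have x0 : 0 <= x + q%:R by lra.
  have := mulr_ge0 d0 x0.
  lra.
have Qup : Q <= s ^+ 2 * S - A%:R * s / 2 + s * H + (\sum_(a < A) a%:R ^+ 2) / 4.
  apply: (@le_trans _ _ (\sum_(a < A) (s ^+ 2 * ((2 * a + 1)%:R ^+ 2)^-1 -
    s / 2 + s * (2 * a%:R + 1)^-1 + a%:R ^+ 2 / 4))).
    by apply: ler_sum => a _; have /andP[] := bnd a.
  rewrite !big_split/= -!mulr_sumr -mulr_suml sumr_const card_ord.
  rewrite -[_ *+ A]mulr_natl -/S -/H.
  lra.
have Qlo : s ^+ 2 * S - A%:R * s / 2 + (\sum_(a < A) a%:R ^+ 2) / 4 -
    (\sum_(a < A) a%:R) / 4 - 2 * s * H <= Q.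
  apply: (@le_trans _ _ (\sum_(a < A) (s ^+ 2 * ((2 * a + 1)%:R ^+ 2)^-1 -
    s / 2 + a%:R ^+ 2 / 4 - a%:R / 4 - 2 * s * (2 * a%:R + 1)^-1))); last first.
    by apply: ler_sum => a _; have /andP[] := bnd a.
  rewrite !big_split/= !sumrN -!mulr_sumr -!mulr_suml sumr_const card_ord.
  rewrite -[_ *+ A]mulr_natl -/S -/H.
  lra.
clearbody S H Q.
move: (\sum_(_ < A) _) (\sum_(_ < A) _) U1 U2 U3 Qup Qlo => X Y *.
by apply/andP; split; lra.
Qed.

Theorem theorem2p2 (R : realType) :
  exists RN : R -> R,
    (forall s : R, 0 < s ->
      (Nplus s)%:R = pi ^+ 2 / 4 * s ^+ 2 - 4 / 3 * s `^ (3 / 2) + RN s) /\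
    RN =O_ +oo (fun s : R => s * ln s).
Proof.
exists (fun s => (Nplus s)%:R - (pi ^+ 2 / 4 * s ^+ 2 - 4 / 3 * s `^ (3 / 2))).
split=> [s _|]; first by rewrite addrC subrK.
(* For large s the error is at most 2 s + 4 s (1 + ln s), and 1 <= ln s. *)
apply/eqO_exP; exists 10; first by rewrite ltr0n.
near=> s.
have s4 : 4 <= s by near: s; exact: nbhs_pinfty_ge.
have s0 : 0 <= s by lra.
have ln1 : 1 <= ln s.
  rewrite -ler_expR lnK ?posrE; last by lra.
  by near: s; exact: nbhs_pinfty_ge.
rewrite [X in _ <= _ * X]ger0_norm; last by rewrite mulr_ge0//; lra.
set r := Num.sqrt s.
have rs : r ^+ 2 = s by rewrite sqr_sqrtr.
have r2 : 2 <= r.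
  by rewrite -(@ler_pXn2r _ 2) ?nnegrE ?sqrtr_ge0// rs -natrX.
have -> : s `^ (3 / 2) = r ^+ 3.
  by rewrite mulrC powRrM powR12_sqrt// powR_mulrn// sqrtr_ge0.
have r0 : 0 <= r by lra.
have /andP[Ar rA] := truncn_itv r0.
pose A := Num.truncn r; rewrite -/A -natr1 in Ar rA.
have A0 : (0 < A)%N by rewrite truncn_gt0; lra.
have /andP[tlo tup] := sum_inv_odd_sqr_tail R A A0.
have As : A%:R ^+ 2 <= s by rewrite -rs ler_pXn2r ?nnegrE.
have sA : s < A.+1%:R ^+ 2 by rewrite -rs -natr1 ltr_pXn2r ?nnegrE ?addr_ge0.
have := Nplus_estimate R s A As sA.
have := main_term_bounds R r A%:R _ r2 Ar rA tlo tup.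
have lnA : ln A%:R <= ln s.
  have s_gt0 : 0 < s by lra.
  by rewrite ler_ln ?posrE ?ltr0n// (le_trans Ar)// -rs; nra.
have := le_trans (sum_inv_odd_le R A A0) (lerD (lexx 1) lnA).
set H := \sum_(_ < A) _; set S := \sum_(_ < A) _ => Hle.
have sH : s * H <= s * (1 + ln s) by rewrite ler_wpM2l.
have sln : s <= s * ln s by rewrite ler_peMr.
have H0 : 0 <= s * H.
  by rewrite mulr_ge0// sumr_ge0// => a _; rewrite invr_ge0 addr_ge0 ?mulr_ge0.
have r4 : r ^+ 4 = s ^+ 2 by rewrite -rs -exprM.
rewrite r4 rs => /andP[m1 m2] /andP[n1 n2].
rewrite ler_norml; apply/andP; split; lra.
Unshelve. all: by end_near.
Qed.
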